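(* Let $k\geq 4$ be an integer and let $G$ be a graph that is $4$-tough, $2k$-connected, and $(P_2\cup kP_1)$-free. Then $G$ is hamiltonian.
   Context: All graphs are finite and simple. For a graph $G$, $c(G)$ denotes the number of components of $G$. For a real number $t\ge 0$, $G$ is $t$-tough if $|S|\ge t\cdot c(G-S)$ for every $S\subseteq V(G)$ with $c(G-S)\ge 2$. For a graph $H$, $G$ is $H$-free if $G$ contains no induced subgraph isomorphic to $H$. $P_2$ denotes the path on two vertices (a single edge), $P_1$ a single vertex, $kP_1$ the graph consisting of $k$ isolated vertices, and $P_2\cup kP_1$ the disjoint union of $P_2$ and $kP_1$. A graph is hamiltonian if it has a cycle through all its vertices. *)

(* Defs.v *)
From mathcomp Require Import all_boot all_order all_algebra.
From mathcomp Require Import reals.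

Set Implicit Arguments.
Unset Strict Implicit.
Unset Printing Implicit Defensive.

(* Finite simple graphs.  The vertex set may be empty. *)
Record sgraph := SGraph {
  vertex :> finType;
  adj : rel vertex;
  adj_sym : symmetric adj;
  adj_irrefl : irreflexive adj
}.

Section Induced.
Variables (G : sgraph) (A : {set G}).

Definition induced_adj : rel {x : G | x \in A} :=
  fun x y => adj (val x) (val y).

Lemma induced_adj_sym : symmetric induced_adj.
Proof. by move=> x y; exact: adj_sym. Qed.

Lemma induced_adj_irrefl : irreflexive induced_adj.
Proof. by move=> x; exact: adj_irrefl. Qed.

Definition induced : sgraph := SGraph induced_adj_sym induced_adj_irrefl.

End Induced.

(* G - S *)
Definition delete_vertices (G : sgraph) (S : {set G}) : sgraph := induced (~: S).

Definition components (G : sgraph) : nat := n_comp (@adj G) {: G}.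

(* The empty graph, with 0 components, is not connected. *)
Definition connected (G : sgraph) : Prop := components G = 1.

Definition k_connected (k : nat) (G : sgraph) : Prop :=
  k < #|G| /\
  forall S : {set G}, #|S| < k -> connected (delete_vertices S).

Definition tough (R : realType) (t : R) (G : sgraph) : Prop :=
  forall S : {set G}, 2 <= components (delete_vertices S) ->
    (t * (components (delete_vertices S))%:R <= #|S|%:R)%R.

Definition isomorphic (G H : sgraph) : Prop :=
  exists2 f : G -> H, bijective f & {mono f : x y / adj x y}.

Definition graph_free (H G : sgraph) : Prop :=
  forall A : {set G}, ~ isomorphic (induced A) H.

Definition hamiltonian (G : sgraph) : Prop :=
  exists c : seq G, [/\ 3 <= size c, ucycle (@adj G) c & forall x, x \in c].

Section PathGraph.
Variable n : nat.

Definition path_adj : rel 'I_n := fun i j => (i.+1 == j :> nat) || (j.+1 == i :> nat).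

Lemma path_adj_sym : symmetric path_adj.
Proof. by move=> i j; exact: orbC. Qed.

Lemma path_adj_irrefl : irreflexive path_adj.
Proof. by move=> i; rewrite /path_adj orbb gtn_eqF. Qed.

(* P_n, with n vertices *)
Definition path_graph : sgraph := SGraph path_adj_sym path_adj_irrefl.

End PathGraph.

Section Edgeless.
Variable n : nat.

Definition no_adj : rel 'I_n := fun _ _ => false.

Lemma no_adj_sym : symmetric no_adj. Proof. by []. Qed.

Lemma no_adj_irrefl : irreflexive no_adj. Proof. by []. Qed.

(* nP_1 *)
Definition isolated_vertices : sgraph := SGraph no_adj_sym no_adj_irrefl.

End Edgeless.

Section DisjointUnion.
Variables G H : sgraph.

Definition union_adj : rel (G + H)%type := fun u v =>
  match u, v with
  | inl x, inl y => adj x y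
  | inr x, inr y => adj x y
  | _, _ => false
  end.

Lemma union_adj_sym : symmetric union_adj.
Proof. by move=> [x|x] [y|y] //; exact: adj_sym. Qed.

Lemma union_adj_irrefl : irreflexive union_adj.
Proof. by move=> [x|x]; exact: adj_irrefl. Qed.

Definition disjoint_union : sgraph := SGraph union_adj_sym union_adj_irrefl.

End DisjointUnion.

(* Main.v *)
Require Import Defs.
From mathcomp Require Import all_boot all_order all_algebra.
From mathcomp Require Import reals.
From mathcomp Require Import zify.

(* Let c be a longest cycle, x a vertex off c, H the component of x in G - c, A
   the set of vertices of c with a neighbour in H, and A+ the set of their
   successors.  Connectivity gives #|A| >= 2k, and maximality of c makes
   I0 = x |: A+ independent.  Call a vertex rich if it has a neighbour in I0, and
   poor otherwise.  By freeness, a rich vertex misses fewer than k vertices of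
   I0, and the poor vertices form an independent set.  As #|A+| >= 2k, two rich
   vertices have two common neighbours a+, b+ in A+; rerouting c through H then
   yields a longer cycle if the two rich vertices are consecutive on c, or if
   they coincide and lie off c.  Hence the successor map injects the rich
   vertices into the poor ones on c; as x is poor too, deleting the rich
   vertices leaves more components than there are deleted vertices. *)

Set Implicit Arguments.
Unset Strict Implicit.
Unset Printing Implicit Defensive.

(** * Forbidden induced subgraphs and component counts *)

Lemma embedding_isomorphic (H G : sgraph) (g : H -> G) :
  injective g -> {mono g : x y / adj x y} ->
  isomorphic (induced (g @: [set: H])) H.
Proof.
move=> g_inj g_mono.
have gP z : g z \in g @: [set: H] by apply: imset_f; rewrite inE.
pose g' z : induced (g @: [set: H]) := Sub (g z) (gP z).
have g'_inj : injective g' by move=> u v /(congr1 val)/g_inj.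
have card_le : #|induced (g @: [set: H])| <= #|H|.
  by rewrite card_sig card_imset // cardsT.
have [f g'K fK] := inj_card_bij g'_inj card_le.
exists f; first by exists g'.
by move=> u v; rewrite -{2}(fK u) -{2}(fK v) [RHS]/= /induced_adj /= g_mono.
Qed.

Definition independent (G : sgraph) (J : {set G}) :=
  {in J &, forall u v, ~~ adj u v}.

(** The form in which freeness is used: the edge [uv] and any [k] vertices of [J] would induce the
    forbidden subgraph. *)
Lemma free_edge_independent (k : nat) (G : sgraph) (u v : G) (J : {set G}) :
  graph_free (disjoint_union (path_graph 2) (isolated_vertices k)) G ->
  adj u v -> independent J ->
  {in J, forall j, ~~ adj u j /\ ~~ adj v j} -> #|J| < k.
Proof.
move=> Gfree uv indJ misJ; rewrite ltnNge; apply/negP=> leJ.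
pose h (i : 'I_k) := enum_val (widen_ord leJ i).
have hJ i : h i \in J by exact: enum_valP.
have h_inj : injective h.
  by move=> i j /enum_val_inj/(congr1 val) /= ij; apply: val_inj.
pose g (z : disjoint_union (path_graph 2) (isolated_vertices k)) : G :=
  match z with inl i => if i == ord0 then u else v | inr i => h i end.
have uJ : u \notin J by apply/negP=> /misJ[_]; rewrite adj_sym uv.
have vJ : v \notin J by apply/negP=> /misJ[]; rewrite uv.
have neq_uv : u != v by apply: contraTneq uv => ->; rewrite adj_irrefl.
have neq_J w : w \notin J -> forall i, w != h i.
  by move=> wJ i; apply: contraNneq wJ => ->.
have g_inj : injective g.
  case=> [i|i] [j|j] /=.
  - case: (i =P ord0) (j =P ord0) => [->|/eqP i0] [->|/eqP j0] //.
    + by move/eqP; rewrite (negPf neq_uv).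
    + by move/eqP; rewrite eq_sym (negPf neq_uv).
    move=> _; congr inl; apply: val_inj.
    by case: i j i0 j0 => [[|[|//]] ?] [[|[|//]] ?].
  - by case: ifP => _ /eqP; rewrite (negPf (neq_J _ _ _)).
  - by case: ifP => _ /esym/eqP; rewrite (negPf (neq_J _ _ _)).
  by move/h_inj->.
apply: (Gfree (g @: [set: _])); apply: embedding_isomorphic g_inj _.
case=> [i|i] [j|j] /=.
- rewrite /path_adj; case: i j => [[|[|//]] ?] [[|[|//]] ?] /=;
    by rewrite ?adj_irrefl ?uv // adj_sym uv.
- by have [/negPf uj /negPf vj] := misJ _ (hJ j); case: ifP.
- by have [/negPf uj /negPf vj] := misJ _ (hJ i); rewrite adj_sym; case: ifP.
by rewrite (negPf (indJ _ _ _ _)).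
Qed.

Lemma adj_connect_sym (G : sgraph) : connect_sym (@adj G).
Proof. exact/sym_connect_sym/adj_sym. Qed.

Lemma connected_connect (G : sgraph) :
  connected G -> forall x y : G, connect (@adj G) x y.
Proof.
rewrite /connected /components /n_comp_mem => /eqP; rewrite eqn_leq => /andP[le1 _] x y.
apply/(fingraph.rootP (@adj_connect_sym G)).
by apply: (card_le1_eqP le1); rewrite inE /= roots_root //; exact: adj_connect_sym.
Qed.

Lemma components_edgeless (G : sgraph) :
  (forall x y : G, ~~ adj x y) -> components G = #|G|.
Proof.
move=> noadj; rewrite /components /n_comp_mem; apply: eq_card => x; rewrite !inE andbT.
rewrite /roots /=; have /connectP[p] := connect_root (@adj G) x.
by case: p => [_ ->|y p] /=; rewrite ?eqxx // (negPf (noadj _ _)).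
Qed.

Lemma components_delete_independent (G : sgraph) (S : {set G}) :
  independent (~: S) -> components (delete_vertices S) = #|~: S|.
Proof.
move=> indS; rewrite components_edgeless ?card_sig //.
by case=> [x xS] [y yS]; exact: indS.
Qed.

(** * Stretches of a cycle and their reversal *)

Section NextSplit.
Variable T : eqType.
Implicit Types (x y : T) (p q r : seq T).

(** Together with injectivity of [next], this identifies the end of a stretch of a cycle as the
    vertex whose successor opens the following stretch. *)
Lemma next_last_cat x p y r :
  uniq (x :: p ++ y :: r) -> next (x :: p ++ y :: r) (last x p) = y.
Proof.
move=> Us; have Uxp : uniq (x :: p).
  by move: Us; rewrite -cat_cons cat_uniq => /andP[].
have last_in : last x p \in x :: p ++ y :: r by rewrite -cat_cons mem_cat mem_last.
rewrite next_nth last_in -cat_cons index_cat mem_last index_last //.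
by rewrite nth_cat ltnn subnn.
Qed.

Lemma next_last x p : uniq (x :: p) -> next (x :: p) (last x p) = x.
Proof.
by move=> Uxp; rewrite next_nth mem_last index_last // nth_default.
Qed.

(** Read backwards, [x :: p] has head [last x p] and tail [rev (belast x p)]; in this form a
    reversed stretch enters a rerouted cycle. *)
Lemma path_rev_belast (e : rel T) x p : symmetric e ->
  path e (last x p) (rev (belast x p)) = path e x p.
Proof. by move=> sym_e; rewrite rev_path; apply: eq_path => u v; exact: sym_e. Qed.

Lemma last_rev_belast x p : last (last x p) (rev (belast x p)) = x.
Proof. by case: p => //= y p; rewrite rev_cons last_rcons. Qed.

Lemma rev_lastI x p : rev (x :: p) = last x p :: rev (belast x p).
Proof. by rewrite lastI rev_rcons. Qed.

(** Reversing and permuting stretches neither loses nor repeats vertices, so a rerouted cycle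
    consists of the old one and the inserted stretches. *)
Lemma perm_rev_crossing2 p1 p2 q r :
  perm_eq (p1 ++ q ++ rev p2 ++ r) ((p1 ++ p2) ++ q ++ r).
Proof. by rewrite -catA perm_cat2l perm_catCA perm_cat2r perm_rev. Qed.

Lemma perm_rev_crossing3 p1 p2 p3 q :
  perm_eq (p3 ++ p2 ++ q ++ rev p1) ((p1 ++ p2 ++ p3) ++ q).
Proof.
rewrite perm_sym -!catA perm_catC -!catA perm_sym perm_catCA !perm_cat2l.
by rewrite perm_rev.
Qed.

End NextSplit.

(** * Rerouting a longest cycle *)

Section LongestCycle.
Variables (G : sgraph) (c : seq G) (H A : {set G}).
Hypothesis cU : ucycle (@adj G) c.
Hypothesis cmax : forall c', ucycle (@adj G) c' -> size c' <= size c.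
Hypothesis Hc : {in H, forall z, z \notin c}.
Hypothesis Ac : {in A, forall a, a \in c}.
(** Connectivity of [H] enters the rerouting only through these detours. *)
Hypothesis detour : {in A &, forall a b, exists q : seq G,
  [/\ q != [::], path (@adj G) a (rcons q b), uniq q & {subset q <= H}]}.

Let symG : symmetric (@adj G) := @adj_sym G.
Let Uc : uniq c := ucycle_uniq cU.

(** Every rerouting ends here: a cycle through [c] and a nonempty [q] would be longer than [c]. *)
Lemma longest_no_extension (q s : seq G) :
  cycle (@adj G) s -> perm_eq s (c ++ q) -> uniq q ->
  {in q, forall z, z \notin c} -> q = [::].
Proof.
move=> cyc_s s_cq Uq qc; have: ucycle (@adj G) s.
  rewrite /ucycle cyc_s (perm_uniq s_cq) cat_uniq Uc Uq andbT /=.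
  by apply/hasPn.
move/cmax; rewrite (perm_size s_cq) size_cat -[X in _ <= X]addn0.
by rewrite leq_add2l leqn0 => /nilP.
Qed.

Lemma rot_cycle_perm i x p q s :
  rot i c = x :: p -> perm_eq s ((x :: p) ++ q) -> perm_eq s (c ++ q).
Proof.
by move=> <- /perm_trans; apply; rewrite perm_cat2r perm_rot.
Qed.

Lemma rot_longestE i s : rot i c = s ->
  [/\ cycle (@adj G) s, uniq s & next s =1 next c].
Proof.
by move=> <-; split; [rewrite rot_cycle ucycle_cycle | rewrite rot_uniq | exact: next_rot].
Qed.

Lemma next_cycle_inj : injective (next c).
Proof. exact: can_inj (prev_next Uc). Qed.

(** Otherwise a detour from [a] to its successor replaces the edge between them and lengthens
    [c]. *)
Lemma next_attachment_notin : {in A, forall a, next c a \notin A}.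
Proof.
move=> a aA; apply/negP=> a'A; have [q [q0 Pq Uq qH]] := detour aA a'A.
have a'c : next c a \in c by rewrite mem_next Ac.
have [i p c_rot] := rot_to a'c.
have [cyc Us nextE] := rot_longestE c_rot.
have lastE : last (next c a) p = a.
  by apply: next_cycle_inj; rewrite -nextE next_last.
have /eqP[] := q0; apply: (@longest_no_extension q ((next c a :: p) ++ q)) => //.
- move: cyc Pq; rewrite /= rcons_cat cat_path rcons_path lastE.
  by case/andP=> -> _ ->.
- exact: rot_cycle_perm c_rot _.
by move=> z /qH/Hc.
Qed.

(* The cycle a+ ... b q a ... b+ r, where the stretch a ... b+ is traversed
   backwards. *)
Lemma no_crossing_outside (a b : G) (r : seq G) :
  a \in A -> b \in A -> a != b ->
  path (@adj G) (next c b) (rcons r (next c a)) -> uniq r ->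
  {in r, forall z, z \notin c} -> {in r, forall z, z \notin H} -> False.
Proof.
move=> aA bA neq_ab Pr Ur rc rH; have [q [q0 Pq Uq qH]] := detour bA aA.
have a'c : next c a \in c by rewrite mem_next Ac.
have [i p c_rot] := rot_to a'c.
have b'p : next c b \in p.
  have: next c b \in rot i c by rewrite mem_rot mem_next Ac.
  rewrite c_rot inE => /orP[/eqP/next_cycle_inj ba|//].
  by rewrite ba eqxx in neq_ab.
case/splitPr: b'p c_rot => p1 p2 c_rot.
have [cyc Us nextE] := rot_longestE c_rot.
have lastb : last (next c a) p1 = b.
  by apply: next_cycle_inj; rewrite -nextE next_last_cat.
have lasta : last (next c b) p2 = a.
  apply: next_cycle_inj; rewrite -nextE.
  by rewrite -[RHS](next_last Us) last_cat.
set x := next c a in Pr a'c c_rot cyc Us nextE lastb *.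
set y := next c b in Pr c_rot cyc Us nextE lasta *.
suff: q ++ r = [::] by case: (q) q0.
apply: (@longest_no_extension _ ((x :: p1) ++ q ++ rev (y :: p2) ++ r)).
- move: cyc Pq Pr; rewrite /= !rcons_cat !cat_path /= rcons_path lastb.
  case/and3P=> -> _; rewrite rcons_path => /andP[Py2 _].
  rewrite rcons_path => /andP[-> qa] Pr /=.
  rewrite rev_lastI /= lasta qa rcons_path -lasta path_rev_belast // Py2.
  by rewrite last_rev_belast.
- apply: rot_cycle_perm c_rot _.
  exact: (perm_rev_crossing2 (x :: p1) (y :: p2)).
- rewrite cat_uniq Uq Ur andbT; apply/hasPn=> z /rH zH.
  by apply: contra zH => /qH.
by move=> z; rewrite mem_cat => /orP[/qH/Hc|/rc].
Qed.

(* The cycle b+ ... w a+ ... b q a ... w+, where the stretch a ... w+ is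
   traversed backwards. *)
Lemma no_ordered_crossing (w a b : G) i p1 p2 p3 :
  a \in A -> b \in A ->
  rot i c = next c w :: p1 ++ next c a :: p2 ++ next c b :: p3 ->
  adj w (next c a) -> adj (next c w) (next c b) -> False.
Proof.
move=> aA bA c_rot wa w'b; have [q [q0 Pq Uq qH]] := detour bA aA.
have [cyc Us nextE] := rot_longestE c_rot.
have lasta : last (next c w) p1 = a.
  by apply: next_cycle_inj; rewrite -nextE next_last_cat.
have lastb : last (next c a) p2 = b.
  apply: next_cycle_inj; rewrite -nextE -[RHS](@next_last_cat _ (next c w)
    (p1 ++ next c a :: p2) _ p3) -?catA //.
  by rewrite last_cat.
have lastw : last (next c b) p3 = w.
  apply: next_cycle_inj; rewrite -nextE -[RHS](next_last Us).
  by rewrite !(last_cat, last_cons).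
set x := next c w in c_rot cyc Us nextE lasta w'b *.
set y := next c a in c_rot cyc Us nextE lastb wa *.
set z := next c b in c_rot cyc Us nextE lastw w'b *.
have /eqP[] := q0.
apply: (@longest_no_extension _ ((z :: p3) ++ (y :: p2) ++ q ++ rev (x :: p1))).
- move: cyc Pq; rewrite /= !rcons_cat /= !cat_path /= rcons_cat cat_path /= lastw lasta.
  case/and4P=> Pp1 _ Pp2 /andP[_]; rewrite !rcons_path => /andP[-> _] /andP[Pq qa].
  rewrite wa cat_path !last_cat Pp2 lastb rev_lastI /= lasta cat_path Pq /= qa.
  by rewrite -lasta path_rev_belast // Pp1 last_rev_belast.
- apply: rot_cycle_perm c_rot _.
  exact: (perm_rev_crossing3 (x :: p1) (y :: p2)).
- by [].
by move=> u /qH/Hc.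
Qed.

(** Opened at [next c w], the cycle meets [next c a] and [next c b] in an unknown order. The four
    adjacencies let [a] and [b] swap roles, so [no_ordered_crossing] applies to either order. *)
Lemma no_crossing_consecutive (w a b : G) :
  w \in c -> a \in A -> b \in A -> a != b ->
  adj w (next c a) -> adj w (next c b) ->
  adj (next c w) (next c a) -> adj (next c w) (next c b) -> False.
Proof.
move=> wc; have w'c : next c w \in c by rewrite mem_next.
have [i p c_rot] := rot_to w'c => aA bA neq_ab wa wb w'a w'b.
have tailP d : d \in A -> adj (next c w) (next c d) -> next c d \in p.
  move=> dA; have: next c d \in rot i c by rewrite mem_rot mem_next Ac.
  by rewrite c_rot inE => /orP[/eqP->|//]; rewrite adj_irrefl.
have := tailP _ aA w'a; have := tailP _ bA w'b.
move=> bp ap; case/splitPr: ap bp c_rot => p1 p2.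
rewrite mem_cat inE (inj_eq next_cycle_inj) (eq_sym b) (negPf neq_ab) /=.
case/orP=> /splitPr[r1 r2]; last by move/no_ordered_crossing; exact.
by rewrite -catA /= => /no_ordered_crossing; exact.
Qed.

End LongestCycle.

(** * The component outside the cycle and its attachments *)

Section OutsideComponent.
Variables (G : sgraph) (c : seq G) (x : G).
Hypothesis xc : x \notin c.

(** A relation on [G] itself rather than on an induced subgraph, so that walks off [c] are sequences
    over [G] that can be spliced into [c]. *)
Definition outside_adj : rel G := fun u v => [&& adj u v, u \notin c & v \notin c].
Definition outside_component : {set G} := [set z | connect outside_adj x z].
Definition attachment : {set G} :=
  [set a in c | [exists h in outside_component, adj a h]].

Let symG : symmetric (@adj G) := @adj_sym G.

Lemma outside_connect_sym : connect_sym outside_adj.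
Proof.
by apply: sym_connect_sym => u v; rewrite /outside_adj symG [X in _ && X]andbC.
Qed.

Lemma outside_component_root : x \in outside_component.
Proof. by rewrite inE connect0. Qed.

Lemma outside_component_notin : {in outside_component, forall z, z \notin c}.
Proof.
have closed_c : closed outside_adj [predC c].
  by move=> u v /and3P[_ uc vc]; rewrite !inE uc vc.
by move=> z; rewrite inE => /(closed_connect closed_c); rewrite !inE xc => <-.
Qed.

Lemma outside_component_closed z y :
  z \in outside_component -> adj z y -> y \notin c -> y \in outside_component.
Proof.
move=> zH zy yc; have zc := outside_component_notin zH.
move: zH; rewrite !inE => /connect_trans; apply; apply: connect1.
by rewrite /outside_adj zy zc yc.
Qed.

Lemma attachmentP a h : a \in c -> h \in outside_component -> adj a h ->
  a \in attachment.
Proof. by move=> ac hH ah; rewrite inE ac; apply/existsP; exists h; rewrite hH. Qed.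

Lemma attachment_detour : {in attachment &, forall a b, exists q : seq G,
  [/\ q != [::], path (@adj G) a (rcons q b), uniq q
    & {subset q <= outside_component}]}.
Proof.
move=> a b; rewrite !inE => /andP[_ /existsP[h /andP[hH ah]]].
move=> /andP[_ /existsP[g /andP[gH bg]]].
have: connect outside_adj h g.
  move: hH gH; rewrite !inE outside_connect_sym; exact: connect_trans.
case/connectP=> p /shortenP[p' Pp' Up' _] gE; exists (h :: p'); split=> //.
  rewrite /= ah rcons_path -gE symG bg andbT.
  by apply: sub_path Pp' => u v /and3P[].
move=> z zp; have hz : connect outside_adj h z by exact: path_connect Pp' _ zp.
by move: hH; rewrite !inE => /connect_trans; apply.
Qed.

(** Deleting fewer than [k] attachments leaves a connected graph, which [outside_component] then
    fills. So every vertex of [c] is an attachment, against [next_attachment_notin]. *)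
Lemma k_connected_attachment k :
  ucycle (@adj G) c ->
  (forall c', ucycle (@adj G) c' -> size c' <= size c) ->
  0 < k -> k_connected k G -> k <= #|attachment|.
Proof.
move=> cU cmax k_gt0 [ltk kconn]; rewrite leqNgt; apply/negP=> /kconn conn.
have xA : x \notin attachment by rewrite inE (negPf xc).
have inH y : y \notin attachment -> y \in outside_component.
  move=> yA; pose D := delete_vertices attachment.
  have xD : x \in ~: attachment by rewrite inE.
  have yD : y \in ~: attachment by rewrite inE.
  have closedH : closed (@adj D) [pred z | val z \in outside_component].
    apply: intro_closed; first exact: adj_connect_sym.
    move=> [u uD] [v vD] uv uH; rewrite -topredE /=.
    have {}uH : u \in outside_component by [].
    have vc : v \notin c.
      apply/negP=> vc; move: (vD); rewrite in_setC => /negP[].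
      by apply: (attachmentP vc uH); rewrite symG.
    exact: outside_component_closed uv vc.
  have := closed_connect closedH (connected_connect conn (Sub x xD : D) (Sub y yD : D)).
  by rewrite !inE /= => <-; exact: connect0.
(* A priori [c] may be empty; but then [x] has a neighbour [z], and [[:: x; z]] counts as a [ucycle]
   of size two. *)
have [c0|c_neq0] := altP (c =P [::]).
  have [y yx] : exists y, y != x.
    apply/existsP; rewrite -negb_forall; apply/negP=> /forallP all_x.
    have: #|G| <= 1 by apply/card_le1_eqP => u v _ _; rewrite (eqP (all_x u)) (eqP (all_x v)).
    by rewrite leqNgt (leq_ltn_trans k_gt0 ltk).
  have: y \in outside_component by apply: inH; rewrite inE c0.
  rewrite inE => /connectP[[|z p] /=]; first by move=> _ yE; rewrite yE eqxx in yx.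
  case/andP=> /and3P[xz _ _] _ _.
  have /cmax: ucycle (@adj G) [:: x; z]; last by rewrite c0.
  rewrite /ucycle /= xz symG xz inE /=.
  by rewrite andbT; apply: contraTneq xz => ->; rewrite adj_irrefl.
have subA a : a \in c -> a \in attachment.
  by move=> ac; apply: contraLR ac => /inH/outside_component_notin.
have [a ac] : exists a, a \in c by case: (c) c_neq0 => // a s _; exists a; rewrite mem_head.
have Ac : {in attachment, forall b, b \in c} by move=> b; rewrite inE => /andP[].
have /negP[] := next_attachment_notin cU cmax outside_component_notin Ac
  attachment_detour (subA _ ac).
by apply: subA; rewrite mem_next.
Qed.

End OutsideComponent.

(** * The longest cycle and the toughness count *)

Lemma longest_ucycle (G : sgraph) : exists2 c : seq G,
  ucycle (@adj G) c & forall c', ucycle (@adj G) c' -> size c' <= size c.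
Proof.
pose P n := [exists t : n.-tuple G, cycle (@adj G) t && uniq t].
have exP : exists n, P n by exists 0; apply/existsP; exists [tuple].
have ubP n : P n -> n <= #|G|.
  by case/existsP=> t /andP[_ Ut]; rewrite -(size_tuple t) -(card_uniqP Ut) max_card.
case: (ex_maxnP exP ubP) => n /existsP[t tU] nmax.
exists t => // c' c'U; rewrite size_tuple; apply: nmax.
by apply/existsP; exists (in_tuple c').
Qed.

Theorem theorem1 (R : realType) (k : nat) (G : sgraph) :
  4 <= k ->
  tough (4%:R : R)%R G ->
  k_connected (2 * k) G ->
  graph_free (disjoint_union (path_graph 2) (isolated_vertices k)) G ->
  hamiltonian G.
Proof.
move=> k4 Gtough Gconn Gfree; have [c cU cmax] := longest_ucycle G.
have [c_all|] := boolP [forall v : G, v \in c].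
  exists c; split=> //; last exact/forallP.
  (* A [ucycle] may have fewer than three vertices; this one covers [G], which has more than
     [2 * k]. *)
  have [ltk _] := Gconn; have: #|G| <= size c.
    apply: leq_trans (card_size c); apply/subset_leq_card/subsetP => v _.
    exact: (forallP c_all).
  lia.
rewrite negb_forall => /existsP[x xc].
pose H := outside_component c x; pose A := attachment c x.
have Ac : {in A, forall a, a \in c} by move=> a; rewrite inE => /andP[].
have Hc : {in H, forall z, z \notin c} := outside_component_notin xc.
have det := attachment_detour (x := x) (c := c).
have leA : 2 * k <= #|A| by apply: k_connected_attachment; rewrite // muln_gt0; lia.
have symG := @adj_sym G.
have next_inj : injective (next c) := next_cycle_inj cU.
pose A1 := [set next c a | a in A]; pose I0 := x |: A1.
have card_A1 : #|A1| = #|A| by rewrite card_imset.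
have A1c : {in A1, forall a, a \in c} by move=> _ /imsetP[a /Ac ac ->]; rewrite mem_next.
(* A neighbour in [H] would make the successor of an attachment an attachment. *)
have A1H : {in A1 & H, forall a h, ~~ adj a h}.
  move=> a' h a'A1 hH; apply/negP=> ah; case/imsetP: (a'A1) => a aA a'E.
  have /negP[] := next_attachment_notin cU cmax Hc Ac det aA.
  by rewrite -a'E; apply: attachmentP ah => //; exact: A1c.
have indA1 : independent A1.
  move=> _ _ /imsetP[a aA ->] /imsetP[b bA ->]; apply/negP=> ab.
  have neq_ab : a != b by apply: contraTneq ab => ->; rewrite adj_irrefl.
  (* With [r] empty, the chord between the two successors closes the longer cycle. *)
  apply: (@no_crossing_outside _ _ _ _ cU cmax Hc Ac det a b [::]) => //.
  by rewrite /= symG ab.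
have indI0 : independent I0.
  move=> u v /setU1P[->|uA] /setU1P[->|vA]; rewrite ?adj_irrefl //.
  - by rewrite symG A1H // outside_component_root.
  - by rewrite A1H // outside_component_root.
  exact: indA1.
pose rich := [set v | [exists s in I0, adj v s]].
(* The edge from [v] to its neighbour [s] in [I0] misses exactly what [v] misses there, as [I0] is
   independent. *)
have few_missed v : v \in rich -> #|[set s in I0 | ~~ adj v s]| < k.
  rewrite inE => /existsP[s /andP[sI vs]].
  apply: (free_edge_independent Gfree vs).
    by move=> a b; rewrite !inE -!in_setU1 => /andP[aI _] /andP[bI _]; exact: indI0.
  by move=> j; rewrite !inE -in_setU1 => /andP[jI vj]; split=> //; exact: indI0.
have common v w : v \in rich -> w \in rich -> exists a b,
  [/\ a \in A, b \in A, a != b, adj v (next c a) && adj v (next c b)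
    & adj w (next c a) && adj w (next c b)].
  move=> /few_missed vm /few_missed wm.
  pose M u := [set s in I0 | ~~ adj u s].
  (* Each of [v] and [w] misses at most [k - 1] of the at least [2 * k] vertices of [A1], so two
     remain. *)
  have: 1 < #|A1 :\: (M v :|: M w)|.
    have := cardsID (M v :|: M w) A1; have := cardsU (M v) (M w).
    have := subset_leq_card (subsetIr A1 (M v :|: M w)).
    rewrite -/(M v) -/(M w) in vm wm; lia.
  have A1P z : z \in A1 :\: (M v :|: M w) -> [/\ z \in A1, adj v z & adj w z].
    case/setDP=> zA1; rewrite !inE -!in_setU1 (setU1r _ zA1) /=.
    by rewrite negb_or !negbK => /andP[].
  case/card_gt1P=> a' [b' [/A1P[/imsetP[a aA ->] va wa] /A1P[/imsetP[b bA ->] vb wb] neq]].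
  exists a, b; rewrite va vb wa wb aA bA; split=> //.
  by apply: contraNneq neq => ->.
have rich_c : {in rich, forall v, v \in c}.
  move=> v vR; apply/negPn/negP=> vc; have vH : v \notin H.
    (* Inside [H], the only possible neighbour in [I0] is [x]; the edge [vx] would then miss all of
       [A1], against freeness. *)
    apply/negP=> vH; move: (vR); rewrite inE => /existsP[s /andP[/setU1P[->|sA1] vs]].
      have := free_edge_independent Gfree vs indA1.
      have xH : x \in H := outside_component_root c x.
      move=> /(_ _) lt; have: #|A1| < k; last by rewrite card_A1; lia.
      by apply: lt => j jA1; rewrite !(symG _ j) !A1H.
    by move: vs; rewrite symG (negPf (A1H _ _ sA1 vH)).
  have [a [b [aA bA neq_ab /andP[va vb] _]]] := common _ _ vR vR.
  apply: (@no_crossing_outside _ _ _ _ cU cmax Hc Ac det a b [:: v]) => //.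
  - by rewrite /= va symG vb.
  - by move=> z; rewrite inE => /eqP->.
  by move=> z; rewrite inE => /eqP->.
have next_rich : {in rich, forall v, next c v \notin rich}.
  move=> v vR; apply/negP=> v'R; have vc := rich_c _ vR.
  have [a [b [aA bA neq_ab /andP[va vb] /andP[v'a v'b]]]] := common _ _ vR v'R.
  exact: (no_crossing_consecutive cU cmax Hc Ac det vc aA bA).
(* An edge between poor vertices would miss all of [I0], which has more than [k] vertices. *)
have ind_poor : independent (~: rich).
  move=> u v; rewrite !inE => /existsPn uP /existsPn vP; apply/negP=> uv.
  have := free_edge_independent Gfree uv indI0.
  move=> lt; have: #|I0| < k.
    by apply: lt => j jI; split; [have := uP j | have := vP j]; rewrite jI.
  by rewrite cardsU1 card_A1; lia.
have lt_rich : #|rich| < #|~: rich|.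
  rewrite -(card_imset rich next_inj); apply/proper_card/properP; split.
    by apply/subsetP=> _ /imsetP[v vR ->]; rewrite inE next_rich.
  exists x; first by rewrite inE; apply: contra xc => /rich_c.
  by apply: contra xc => /imsetP[v /rich_c vc ->]; rewrite mem_next.
(* With [lt_rich], this provides the two components that toughness asks for; any attachment is rich
   through its own successor. *)
have rich_gt0 : 0 < #|rich|.
  have /card_gt0P[a aA] : 0 < #|A| by lia.
  apply/card_gt0P; exists a.
  rewrite inE; apply/existsP; exists (next c a); rewrite setU1r ?imset_f //.
  exact: next_cycle (ucycle_cycle cU) (Ac _ aA).
have := Gtough rich; rewrite components_delete_independent // => /(_ (leq_trans _ lt_rich)).
move=> /(_ rich_gt0); rewrite -GRing.natrM Num.Theory.ler_nat; lia.
Qed.
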